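(* Let $V$ be a 3-dimensional complex vector space with a Hermitian form $h$ of signature $(2,1)$. Let $z_1,z_2,z_3\in V$ be linearly independent non-null vectors such that the restrictions of $h$ to $\langle z_1,z_2\rangle$ and $\langle z_2,z_3\rangle$ are nondegenerate. Put $a_i=h(z_i,z_i)$, $h_{ij}=h(z_i,z_j)$, $\Delta_{ij}=a_ia_j-|h_{ij}|^2$, $q_{ij}=\Delta_{ij}/(a_ia_j)$, $D_{123}=\det(h_{ij})_{1\le i,j\le3}$, $\Omega_{123}=\dfrac{h_{12}h_{23}h_{31}}{a_1a_2a_3}$, $\Theta_{123}=\Omega_{123}+\overline{\Omega_{123}}$. Let $p_3\neq0$ satisfy $h(p_3,z_1)=h(p_3,z_2)=0$ and $p_1\neq 0$ satisfy $h(p_1,z_2)=h(p_1,z_3)=0$, with $p_1,p_3$ non-null. Suppose $h(p_3,p_1)=0$, equivalently the vertex spread $s_2=1-\dfrac{|h(p_3,p_1)|^2}{h(p_3,p_3)h(p_1,p_1)}$ at $z_2$ equals $1$. Then $$q_{12}\,q_{23}=q_{12}+q_{23}+q_{31}-2+\Theta_{123};$$ equivalently, $$\Delta_{12}\,\Delta_{23}=a_2\,D_{123}.$$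
   Context: $h$ is linear in the first argument and conjugate-linear in the second; a vector $z$ is non-null if $h(z,z)\neq0$. *)

(* Defs.v *)
From HB Require Import structures.
From mathcomp Require Import all_boot all_order all_algebra.
From mathcomp Require Export reals complex.

Set Implicit Arguments.
Unset Strict Implicit.
Unset Printing Implicit Defensive.

Import Order.TTheory GRing.Theory Num.Theory.
Local Open Scope ring_scope.

(* [{hermitian_sym V for Num.conj}] is linear in its first argument and
   conjugate-linear in its second one. *)
Section HermitianGeometry.
Variables (C : numClosedFieldType) (V : vectType C).
Implicit Types (h : {hermitian_sym V for Num.conj}) (U : {vspace V}).
Implicit Types u v w : V.

Definition hform_restr h U (u v : subvs_of U) : C := h (vsval u) (vsval v).

Section RestrictionIsHermitian.
Variables (h : {hermitian_sym V for Num.conj}) (U : {vspace V}).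
Local Notation hU := (@hform_restr h U).

Fact hform_restr_bilinear :
  bilinear_for ( *%R : GRing.Scale.law C C)
    (Num.conj \; *%R : GRing.Scale.law C C) hU.
Proof.
split=> w a u v /=; first by rewrite /hform_restr linearP linearPl.
by rewrite /hform_restr linearP.
Qed.

Fact hform_restr_hermitian (u v : subvs_of U) : hU u v = (-1) ^+ false * Num.conj (hU v u).
Proof. exact: hermitian_subproof. Qed.

HB.instance Definition _ := bilinear_isBilinear.Build C _ _ _ _ _ hU
  hform_restr_bilinear.
HB.instance Definition _ := isHermitianSesquilinear.Build C _ _ _ hU
  hform_restr_hermitian.

Definition nondegenerate_on : bool := nondegenerate hU.
End RestrictionIsHermitian.

(* Sylvester: [0 < x] and [x < 0] in [C] include that [x] is real. *)
Definition has_signature h (p q : nat) : Prop :=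
  exists e : (p + q).-tuple V,
    [/\ basis_of fullv e,
        forall i j : 'I_(p + q), i != j -> h e`_i e`_j = 0,
        forall i : 'I_(p + q), (i < p)%N -> 0 < h e`_i e`_i
      & forall i : 'I_(p + q), (p <= i)%N -> h e`_i e`_i < 0].

Definition non_null h v : Prop := h v v != 0.

Definition Delta h u v : C := h u u * h v v - `|h u v| ^+ 2.

Definition quadrance h u v : C := Delta h u v / (h u u * h v v).

Definition gram h (k : nat) (s : k.-tuple V) : 'M[C]_k :=
  \matrix_(i, j) h s`_i s`_j.

Definition Omega h u v w : C :=
  (h u v * h v w * h w u) / (h u u * h v v * h w w).

Definition Theta h u v w : C := Omega h u v w + Num.conj (Omega h u v w).

(* Spread at the common vertex of two lines with polar vectors [u] and [v]. *)
Definition spread h u v : C := 1 - `|h u v| ^+ 2 / (h u u * h v v).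

End HermitianGeometry.

(* Main.v *)
(* The identity Delta_12 Delta_23 - a_2 D_123 = |h_12 h_23 - a_2 h_13|^2 reduces
   the Gram relation to h_12 h_23 = a_2 h_13.  If p_1 is orthogonal to p_3, then
   p_1 lies in the plane of z_1 and z_2; being orthogonal to z_2, it is a
   multiple of a_2 z_1 - h_12 z_2, and its orthogonality to z_3 is the required
   equality.  The spread relation is the Gram relation divided by
   a_1 a_2^2 a_3. *)
Require Import Defs.
From mathcomp Require Import all_boot all_order all_algebra.
From mathcomp Require Import ring.
Import Order.TTheory GRing.Theory Num.Theory.
Local Open Scope ring_scope.
Local Open Scope complex_scope.

Lemma det_mx2E (R : comPzRingType) (A : 'M[R]_2) :
  \det A = A ord0 ord0 * A ord_max ord_max - A ord0 ord_max * A ord_max ord0.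
Proof.
rewrite (expand_det_row _ ord0) !big_ord_recl big_ord0 /cofactor !det_mx11.
rewrite !mxE /= /bump /= expr0 expr1 mul1r mulN1r mulrN addr0.
by congr (_ * A _ _ - A _ _ * A _ _); apply: val_inj.
Qed.

Section Triangle.
Variables (C : numClosedFieldType) (V : vectType C).
Variable h : {hermitian_sym V for Num.conj}.
Implicit Types u v w p q x : V.

Lemma herm_conj u v : Num.conj (h u v) = h v u.
Proof. by rewrite [RHS]hermC expr0 mul1r. Qed.

Lemma herm_norm_sqr u v : `|h u v| ^+ 2 = h u v * h v u.
Proof. by rewrite normCK herm_conj. Qed.

Lemma herm_orthC u v : h u v = 0 -> h v u = 0.
Proof. by move=> h0; rewrite -herm_conj h0 rmorph0. Qed.

Lemma det_gram3 u v w : \det (gram h [tuple u; v; w]) =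
  h u u * h v v * h w w + h u v * h v w * h w u + h u w * h v u * h w v
  - h u u * (h v w * h w v) - h v v * (h u w * h w u) - h w w * (h u v * h v u).
Proof.
rewrite (expand_det_row _ ord0) !big_ord_recl big_ord0 /cofactor.
rewrite !det_mx2E !mxE /=.
by ring.
Qed.

(** Desnanot-Jacobi condensation around the central entry [h v v] of the Gram matrix: the two
    [Delta]s are principal 2x2 minors, and the two off-diagonal corner minors are complex conjugates
    of each other, so their product is a squared modulus. *)
Lemma Delta_mul_gram u v w :
  Delta h u v * Delta h v w - h v v * \det (gram h [tuple u; v; w]) =
  `|h u v * h v w - h v v * h u w| ^+ 2.
Proof.
rewrite normCK rmorphB !rmorphM /= !herm_conj /Delta !herm_norm_sqr det_gram3.
by ring.
Qed.

(** The denominator of [Omega] is real, so conjugation only reverses the cyclic product in the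
    numerator. The sum of the two products is exactly the pair of 3-cycle terms of the Gram
    determinant. *)
Lemma ThetaE u v w : Theta h u v w =
  (h u v * h v w * h w u + h u w * h v u * h w v) / (h u u * h v v * h w w).
Proof.
rewrite /Theta /Omega rmorphM fmorphV !rmorphM /= !herm_conj -mulrDl.
by congr (_ / _); ring.
Qed.

(** Each quadrance is 1 minus a normalized transposition term of the determinant; the constant 3 - 2
    = 1 is its normalized diagonal term, and [Theta] supplies the 3-cycles. *)
Lemma quadrance_relationE u v w :
    non_null h u -> non_null h v -> non_null h w ->
  quadrance h u v + quadrance h v w + quadrance h w u - 2%:R + Theta h u v w =
  \det (gram h [tuple u; v; w]) / (h u u * h v v * h w w).
Proof.
rewrite /non_null => hu hv hw.
rewrite ThetaE det_gram3 /quadrance /Delta !herm_norm_sqr.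
by field; rewrite hu hv hw.
Qed.

Lemma quadrance_relation_gram u v w :
    non_null h u -> non_null h v -> non_null h w ->
  quadrance h u v * quadrance h v w =
    quadrance h u v + quadrance h v w + quadrance h w u - 2%:R + Theta h u v w
  <-> Delta h u v * Delta h v w = h v v * \det (gram h [tuple u; v; w]).
Proof.
move=> hu hv hw; rewrite quadrance_relationE //.
set D := \det _; move: hu hv hw; rewrite /non_null => hu hv hw.
(* Both sides are brought over the same nonzero denominator, so that only the numerators remain to
   be compared. *)
have -> : quadrance h u v * quadrance h v w =
    Delta h u v * Delta h v w / (h v v * (h u u * h v v * h w w)).
  by rewrite /quadrance; field; rewrite hu hv hw.
have -> : D / (h u u * h v v * h w w) =
    h v v * D / (h v v * (h u u * h v v * h w w)).
  by field; rewrite hu hv hw.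
split=> [|-> //]; apply: mulIf.
by rewrite invr_eq0 !mulf_neq0.
Qed.

Lemma spread_eq1 u v : non_null h u -> non_null h v ->
  h u v = 0 <-> spread h u v = 1.
Proof.
rewrite /non_null /spread => hu hv; split=> [->|].
  by rewrite normr0 expr0n mul0r subr0.
move/(congr1 (fun t => 1 - t)) => /eqP; rewrite subKr subrr mulf_eq0 invr_eq0.
by rewrite expf_eq0 mulf_eq0 (negPf hu) (negPf hv) !orbF normr_eq0 =>/eqP.
Qed.

(** A non-null [p] orthogonal to [u] and [v] completes them to a basis of the 3-dimensional space;
    pairing [x] with [p] then kills the coefficient of [x] along [p]. *)
Lemma orth_plane_mem p u v x : \dim {:V} = 3%N -> free [:: u; v] ->
    non_null h p -> h p u = 0 -> h p v = 0 -> h p x = 0 ->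
  exists a b, x = a *: u + b *: v.
Proof.
rewrite /non_null => dimV uv_free p_nn pu pv px.
have pN : p \notin <<[:: u; v]>>%VS.
  (* A vector of the plane that is orthogonal to the plane would be null. *)
  apply/negP; rewrite span_cons span_seq1 => /memv_addP[_ /vlineP[a ->]].
  move=> [_ /vlineP[b ->]] pE; case/eqP: p_nn.
  by rewrite {2}pE linearD !linearZ /= pu pv !mulr0 addr0.
have puv_free : free [:: p; u; v] by rewrite free_cons pN.
have : x \in <<[:: p; u; v]>>%VS.
  suff -> : <<[:: p; u; v]>>%VS = fullv by exact: memvf.
  by apply/eqP; rewrite eqEdim subvf dimV (eqP puv_free).
rewrite !span_cons span_nil addv0.
move=> /memv_addP[_ /vlineP[c ->]].
move=> [_ /memv_addP[_ /vlineP[a ->] [_ /vlineP[b ->] ->]] xE]; exists a, b; rewrite xE.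
have : h x p = 0 by exact: herm_orthC.
rewrite xE !linearDl !linearZl_LR /= (herm_orthC _ _ pu) (herm_orthC _ _ pv).
rewrite !mulr0 !addr0 => /eqP; rewrite mulf_eq0 (negPf p_nn) orbF => /eqP ->.
by rewrite scale0r add0r.
Qed.

Lemma orth_polar_mul p q u v w : \dim {:V} = 3%N -> free [:: u; v] ->
    non_null h v -> non_null h p -> q != 0 ->
    h p u = 0 -> h p v = 0 -> h q v = 0 -> h q w = 0 -> h p q = 0 ->
  h u v * h v w = h v v * h u w.
Proof.
move=> dimV uv_free v_nn p_nn q0 pu pv qv qw pq.
have [a [b qE]] := orth_plane_mem _ _ _ _ dimV uv_free p_nn pu pv pq.
move: qv qw; rewrite qE !linearDl !linearZl_LR /= => qv qw.
(* If [a] were 0, then [b * h v v = 0] would force [b = 0], hence [q = 0]. *)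
have a0 : a != 0.
  apply: contra q0 => /eqP a0; move: qv; rewrite qE a0 mul0r add0r => /eqP.
  by rewrite mulf_eq0 (negPf v_nn) orbF => /eqP ->; rewrite !scale0r addr0.
apply: (mulfI a0); apply/eqP; rewrite -subr_eq0; apply/eqP.
(* Elimination of [b] from the two equations [h q v = 0] and [h q w = 0]. *)
transitivity ((a * h u v + b * h v v) * h v w - h v v * (a * h u w + b * h v w)).
  by ring.
by rewrite qv qw mul0r mulr0 subr0.
Qed.

End Triangle.

Theorem corollary10p6 (R : realType) (V : vectType R[i])
    (h : {hermitian_sym V for Num.conj})
    (dimV : \dim {:V} = 3%N) (sig_h : has_signature h 2 1)
    (z1 z2 z3 : V) (free_z : free [:: z1; z2; z3])
    (z1_nn : non_null h z1) (z2_nn : non_null h z2) (z3_nn : non_null h z3)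
    (nd12 : nondegenerate_on h <<[:: z1; z2]>>%VS)
    (nd23 : nondegenerate_on h <<[:: z2; z3]>>%VS)
    (p1 p3 : V)
    (p3_neq0 : p3 != 0) (p3z1 : h p3 z1 = 0) (p3z2 : h p3 z2 = 0)
    (p1_neq0 : p1 != 0) (p1z2 : h p1 z2 = 0) (p1z3 : h p1 z3 = 0)
    (p1_nn : non_null h p1) (p3_nn : non_null h p3) :
  let q12 := quadrance h z1 z2 in
  let q23 := quadrance h z2 z3 in
  let q31 := quadrance h z3 z1 in
  let s2 := spread h p3 p1 in
  let D123 := \det (gram h [tuple z1; z2; z3]) in
  let spread_relation :=
    q12 * q23 = q12 + q23 + q31 - 2%:R + Theta h z1 z2 z3 in
  let gram_relation :=
    Delta h z1 z2 * Delta h z2 z3 = h z2 z2 * D123 in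
  [/\ h p3 p1 = 0 <-> s2 = 1,
      spread_relation <-> gram_relation
    & h p3 p1 = 0 -> spread_relation /\ gram_relation].
Proof.
move=> q12 q23 q31 s2 D123 spread_relation gram_relation.
have rel_iff : spread_relation <-> gram_relation.
  exact: quadrance_relation_gram.
split=> //; first exact: spread_eq1.
move=> p31; suff gram_holds : gram_relation by split=> //; apply/rel_iff.
apply/eqP; rewrite -subr_eq0 Delta_mul_gram.
have z12_free : free [:: z1; z2].
  exact: (@catl_free _ _ [:: z3] [:: z1; z2] free_z).
(* Here [p3] is the normal of the plane of [z1] and [z2], and [p1] is the vector expanded in that
   plane. *)
by rewrite (orth_polar_mul _ _ h p3 p1) // subrr normr0 expr0n.
Qed.
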